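(* Let $n\in\mathbb N$. The variety $\mathbf{HSP}(\mathbf Z_n)$ is axiomatized, as a subvariety of $p\mathbb{AL}^+$, by the set of inequalities $\{(\text{s-rank}_n)\}\cup\{(\mathrm{div}_{p,n}) \mid p\in\mathbb N,\ p \text{ does not divide } n,\ p<n\}$.
   Context: A pointed Abelian $\ell$-group is an Abelian $\ell$-group expanded by a constant $\mathtt f$; $p\mathbb{AL}^+$ is the variety of those with $\mathtt f\ge 0$. $\mathbf Z_n$ is the $\ell$-group of integers with $\mathtt f$ interpreted as $n$. $\mathbf{HSP}(\mathcal K)$ is the variety generated by $\mathcal K$. $k\cdot t$ is the $k$-fold sum of $t$. An inequality $t\ge0$ holds in an algebra if $t\wedge 0=0$ under every evaluation. The inequalities are: $(\text{s-rank}_n)$: $(n\cdot x-\mathtt f)\vee(-x)\ge 0$; $(\mathrm{div}_{p,n})$: $((n+1)\cdot((p\cdot x-\mathtt f)\vee(\mathtt f-p\cdot x))-\mathtt f)\vee(-x)\ge 0$. *)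

(* Defs.v *)
From HB Require Import structures.
From mathcomp Require Import all_boot all_order all_algebra.
From mathcomp Require Import boolp.

Set Implicit Arguments.
Unset Strict Implicit.
Unset Printing Implicit Defensive.

Import Order.TTheory GRing.Theory Num.Theory.
Local Open Scope ring_scope.

(* Meet and join are fields of the mixin because Hierarchy Builder rejects a new
   join of zmodType and latticeType located below realDomainType.  The order is
   the one of the lattice: x <= y iff lmeet x y = x. *)
HB.mixin Record isLGroup A of GRing.Zmodule A := {
  lmeet : A -> A -> A;
  ljoin : A -> A -> A;
  lmeetC : commutative lmeet;
  ljoinC : commutative ljoin;
  lmeetA : associative lmeet;
  ljoinA : associative ljoin;
  lmeet_joinK : forall x y : A, lmeet x (ljoin x y) = x;
  ljoin_meetK : forall x y : A, ljoin x (lmeet x y) = x;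
  lmeet_leD2l : forall x y z : A,
    lmeet x y = x -> lmeet (z + x) (z + y) = z + x
}.

#[short(type="abelianLGroupType")]
HB.structure Definition AbelianLGroup := {A of GRing.Zmodule A & isLGroup A}.

HB.mixin Record isPointed A := { point : A }.

#[short(type="pointedLGroupType")]
HB.structure Definition PointedLGroup := {A of AbelianLGroup A & isPointed A}.

Definition lle (A : abelianLGroupType) (x y : A) : Prop := lmeet x y = x.

Definition alg_class : Type := pointedLGroupType -> Prop.

Definition pAL_plus : alg_class := fun A => lle (0 : A) point.

Definition pointed_int (n : nat) : Type := int.

Section PointedInt.
Variable n : nat.

HB.instance Definition _ := GRing.Zmodule.copy (pointed_int n) int.

Fact int_min_leD2l (x y z : int) :
  Num.min x y = x -> Num.min (z + x) (z + y) = z + x.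
Proof. by move=> xy; rewrite -addr_minr xy. Qed.

HB.instance Definition _ := isLGroup.Build (pointed_int n)
  (@minC _ int) (@maxC _ int) (@minA _ int) (@maxA _ int)
  (@maxKx _ int) (@minKx _ int) int_min_leD2l.
HB.instance Definition _ := isPointed.Build (pointed_int n) (Posz n).

End PointedInt.

Definition ZZ (n : nat) : pointedLGroupType := pointed_int n.

Definition direct_prod (I : Type) (A_ : I -> pointedLGroupType) : Type :=
  forall i, A_ i.

Section DirectProduct.
Variables (I : Type) (A_ : I -> pointedLGroupType).
Local Notation P := (direct_prod A_).
Implicit Types f g h : P.

HB.instance Definition _ := gen_eqMixin P.
HB.instance Definition _ := gen_choiceMixin P.

Definition prod_zero : P := fun i => 0.
Definition prod_opp f : P := fun i => - f i.
Definition prod_add f g : P := fun i => f i + g i.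
Definition prod_meet f g : P := fun i => lmeet (f i) (g i).
Definition prod_join f g : P := fun i => ljoin (f i) (g i).
Definition prod_point : P := fun i => point.

Fact prod_addA : associative prod_add.
Proof. by move=> f g h; apply: functional_extensionality_dep => i; apply: addrA. Qed.
Fact prod_addC : commutative prod_add.
Proof. by move=> f g; apply: functional_extensionality_dep => i; apply: addrC. Qed.
Fact prod_add0 : left_id prod_zero prod_add.
Proof. by move=> f; apply: functional_extensionality_dep => i; apply: add0r. Qed.
Fact prod_addN : left_inverse prod_zero prod_opp prod_add.
Proof. by move=> f; apply: functional_extensionality_dep => i; apply: addNr. Qed.

HB.instance Definition _ :=
  GRing.isZmodule.Build P prod_addA prod_addC prod_add0 prod_addN.

Fact prod_meetC : commutative prod_meet.
Proof. by move=> f g; apply: functional_extensionality_dep => i; apply: lmeetC. Qed.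
Fact prod_joinC : commutative prod_join.
Proof. by move=> f g; apply: functional_extensionality_dep => i; apply: ljoinC. Qed.
Fact prod_meetA : associative prod_meet.
Proof. by move=> f g h; apply: functional_extensionality_dep => i; apply: lmeetA. Qed.
Fact prod_joinA : associative prod_join.
Proof. by move=> f g h; apply: functional_extensionality_dep => i; apply: ljoinA. Qed.
Fact prod_meet_joinK f g : prod_meet f (prod_join f g) = f.
Proof. by apply: functional_extensionality_dep => i; apply: lmeet_joinK. Qed.
Fact prod_join_meetK f g : prod_join f (prod_meet f g) = f.
Proof. by apply: functional_extensionality_dep => i; apply: ljoin_meetK. Qed.
Fact prod_meet_leD2l f g h :
  prod_meet f g = f -> prod_meet (h + f) (h + g) = h + f.
Proof.
move=> fg; apply: functional_extensionality_dep => i; apply: lmeet_leD2l.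
by rewrite -[RHS](congr1 (fun k : P => k i) fg).
Qed.

HB.instance Definition _ := isLGroup.Build P prod_meetC prod_joinC
  prod_meetA prod_joinA prod_meet_joinK prod_join_meetK prod_meet_leD2l.
HB.instance Definition _ := isPointed.Build P prod_point.

End DirectProduct.

Record is_hom (A B : pointedLGroupType) (h : A -> B) : Prop := IsHom {
  hom_zero : h 0 = 0;
  hom_opp : {morph h : x / - x};
  hom_add : {morph h : x y / x + y};
  hom_meet : {morph h : x y / lmeet x y};
  hom_join : {morph h : x y / ljoin x y};
  hom_point : h point = point
}.

Inductive opP (K : alg_class) : alg_class :=
  OpP (I : Type) (A_ : I -> pointedLGroupType) :
    (forall i, K (A_ i)) -> opP K (direct_prod A_).

(* Subalgebras are taken up to isomorphism, as embedded algebras; this does not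
   change HSP since opH is closed under isomorphism. *)
Definition opS (K : alg_class) : alg_class := fun B =>
  exists2 A, K A & exists2 h : B -> A, is_hom h & injective h.

Definition opH (K : alg_class) : alg_class := fun B =>
  exists2 A, K A & exists2 h : A -> B, is_hom h & forall b, exists a, h a = b.

Definition HSP (K : alg_class) : alg_class := opH (opS (opP K)).

Inductive term : Type :=
  | TVar of nat
  | TZero
  | TOpp of term
  | TAdd of term & term
  | TMeet of term & term
  | TJoin of term & term
  | TPoint.

Fixpoint eval (A : pointedLGroupType) (e : nat -> A) (t : term) : A :=
  match t with
  | TVar i => e i
  | TZero => 0
  | TOpp s => - eval e s
  | TAdd s u => eval e s + eval e u
  | TMeet s u => lmeet (eval e s) (eval e u)
  | TJoin s u => ljoin (eval e s) (eval e u)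
  | TPoint => point
  end.

Definition TSub (s t : term) : term := TAdd s (TOpp t).
Definition TMuln (k : nat) (t : term) : term := iter k (TAdd t) TZero.

Definition ineq_holds (A : pointedLGroupType) (t : term) : Prop :=
  forall e : nat -> A, eval e (TMeet t TZero) = 0.

(* Each t in Sigma stands for the inequality t >= 0. *)
Definition axiomatized_within (V W : alg_class) (Sigma : term -> Prop) : Prop :=
  forall A, V A <-> W A /\ (forall t, Sigma t -> ineq_holds A t).

Definition s_rank (n : nat) : term :=
  let x := TVar 0 in
  TJoin (TSub (TMuln n x) TPoint) (TOpp x).

Definition div_ineq (p n : nat) : term :=
  let x := TVar 0 in
  let d := TJoin (TSub (TMuln p x) TPoint) (TSub TPoint (TMuln p x)) in
  TJoin (TSub (TMuln n.+1 d) TPoint) (TOpp x).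

Definition rank_div_axioms (n : nat) (t : term) : Prop :=
  t = s_rank n \/
  exists p : nat, [/\ ~~ (p %| n)%N, (p < n)%N & t = div_ineq p n].

(* Main.v *)
(* An Abelian l-group A embeds into a product of totally ordered ones, obtained
   here as total cones on A by Zorn's lemma.  In a totally ordered group G the
   rank inequality says that n x >= f for all x > 0; hence, if f > 0, G has a
   least positive element u and f = m u with m <= n, and the divisibility
   inequalities force m to divide n.  A finitely generated subgroup of G splits
   as Zu + F with F free and ordered above Zu, so any finite set of inequalities
   between its elements can be reproduced by a homomorphism to Z that sends u
   to 1 (Fourier-Motzkin elimination on F, then scaling).  Multiplying by n/m
   lands in Z_n.  If f = 0, one lands in Z_0 instead; multiplying by a large
   integer makes the difference between f = 0 and f = n negligible.  Thus an
   inequality that fails in A fails in Z_n, and A is a quotient of the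
   subalgebra of the product of all Z_n^(valuations A -> Z) generated by the
   projections. *)

From HB Require Import structures.
From mathcomp Require Import all_boot all_order all_algebra.
From mathcomp Require Import boolp classical_sets.
From mathcomp Require Import zify ring lra.
(* Last, so that [point] is not the one of classical_sets. *)
Require Import Defs.

Set Implicit Arguments.
Unset Strict Implicit.
Unset Printing Implicit Defensive.

Import Order.TTheory GRing.Theory Num.Theory.
Local Open Scope ring_scope.

(** * Prime cones of Abelian l-groups *)

Section LGroupOrder.
Variable A : abelianLGroupType.
Implicit Types x y z a b : A.

Lemma lle_refl x : lle x x.
Proof. by rewrite /lle -{2}(ljoin_meetK x x) lmeet_joinK. Qed.

Lemma lle_trans y x z : lle x y -> lle y z -> lle x z.
Proof. by rewrite /lle => xy yz; rewrite -xy -lmeetA yz. Qed.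

Lemma lle_anti x y : lle x y -> lle y x -> x = y.
Proof. by rewrite /lle => xy yx; rewrite -xy lmeetC yx. Qed.

Lemma lle_meetl x y : lle (lmeet x y) x.
Proof. by rewrite /lle lmeetC lmeetA lle_refl. Qed.

Lemma lle_meetr x y : lle (lmeet x y) y.
Proof. by rewrite lmeetC; apply: lle_meetl. Qed.

Lemma lle_meet x y z : lle z x -> lle z y -> lle z (lmeet x y).
Proof. by rewrite /lle => zx zy; rewrite lmeetA zx. Qed.

Lemma lle_joinl x y : lle x (ljoin x y).
Proof. exact: lmeet_joinK. Qed.

Lemma lle_joinr x y : lle y (ljoin x y).
Proof. by rewrite ljoinC; apply: lle_joinl. Qed.

Lemma lle_join x y z : lle x z -> lle y z -> lle (ljoin x y) z.
Proof.
have joinE (u v : A) : lle u v -> ljoin u v = v.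
  by move=> uv; rewrite -uv ljoinC lmeetC ljoin_meetK.
move=> xz yz; rewrite -(joinE _ _ xz) -(joinE _ _ yz) ljoinA.
exact: lle_joinl.
Qed.

Lemma lleD2l z x y : lle x y -> lle (z + x) (z + y).
Proof. exact: lmeet_leD2l. Qed.

Lemma lleD x y z t : lle x y -> lle z t -> lle (x + z) (y + t).
Proof.
move=> xy zt; apply: (@lle_trans (x + t)); first exact: lleD2l.
by rewrite ![_ + t]addrC; apply: lleD2l.
Qed.

Lemma lle_subLR x y z : lle (x - y) z <-> lle x (y + z).
Proof.
split=> [/(lleD2l y)|/(lleD2l (- y))]; first by rewrite addrCA subrr addr0.
by rewrite addrA addNr add0r addrC.
Qed.

Lemma lle_sub0 x y : lle 0 (y - x) <-> lle x y.
Proof.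
split=> [/(lleD2l x)|/(lleD2l (- x))]; first by rewrite addr0 addrCA subrr addr0.
by rewrite addNr addrC.
Qed.

Lemma lleN2 x y : lle x y -> lle (- y) (- x).
Proof. by move=> /lle_sub0 h; apply/lle_sub0; rewrite opprK addrC. Qed.

Lemma lle0_add x y : lle 0 x -> lle 0 y -> lle 0 (x + y).
Proof. by move=> x0 y0; rewrite -[0]addr0; apply: lleD. Qed.

(** For nonnegative x and y this is [lmeet x y = 0], phrased through lower bounds. *)
Definition disjoint x y := forall z, lle z x -> lle z y -> lle z 0.

Lemma disjointC x y : disjoint x y -> disjoint y x.
Proof. by move=> d z zy zx; apply: d. Qed.

(** For t below x and y + z, the element t - y is below z, and below x because y >= 0. Hence t - y
    <= 0, so t is below both x and y. *)
Lemma disjointD x y z : lle 0 y -> disjoint x y -> disjoint x z -> disjoint x (y + z).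
Proof.
move=> y0 dy dz t tx tyz; apply: dy => //.
have /lle_subLR : lle (t - y) 0; last by rewrite addr0.
apply: dz; last exact/lle_subLR.
by apply: lle_trans tx; apply/lle_subLR; rewrite -{1}[t]add0r; apply: lleD => //; apply: lle_refl.
Qed.

Lemma disjointMn x y k : lle 0 y -> disjoint x y -> disjoint x (y *+ k).
Proof.
move=> y0 d; elim: k => [|k ih]; first by rewrite mulr0n.
by rewrite mulrS; apply: disjointD.
Qed.

Definition negpart x := ljoin (- x) 0.

Lemma negpart_ge0 x : lle 0 (negpart x).
Proof. exact: lle_joinr. Qed.

Lemma negpart_ge x : lle (- x) (negpart x).
Proof. exact: lle_joinl. Qed.

Lemma negpart_le x z : lle (- x) z -> lle 0 z -> lle (negpart x) z.
Proof. exact: lle_join. Qed.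

Lemma negpart_eq0 x : lle 0 x <-> negpart x = 0.
Proof.
split=> [x0|n0].
  apply: lle_anti (negpart_ge0 x); apply: negpart_le (lle_refl 0).
  by rewrite -oppr0; apply: lleN2.
by move: (lleN2 (negpart_ge x)); rewrite n0 opprK oppr0.
Qed.

Lemma negpartD x y : lle (negpart (x + y)) (negpart x + negpart y).
Proof.
apply: negpart_le; last by apply: lle0_add; apply: negpart_ge0.
by rewrite opprD; apply: lleD; apply: negpart_ge.
Qed.

(** With b = [negpart x], the positive part [negpart (- x)] is at most x + b. A common lower bound z
    thus makes b - z an upper bound of both - x and 0, so b <= b - z. *)
Lemma disjoint_negpart x : disjoint (negpart x) (negpart (- x)).
Proof.
set b := negpart x => z zb zNb.
have xb : lle (negpart (- x)) (x + b).
  apply: negpart_le; last by apply/lle_subLR; rewrite add0r; apply: negpart_ge.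
  by rewrite opprK -{1}[x]addr0; apply/lleD2l/negpart_ge0.
have : lle b (b - z).
  apply: negpart_le; last exact/lle_sub0.
  apply/lle_sub0; rewrite opprK addrC addrA; apply/lle_sub0.
  exact: lle_trans zNb xb.
by move=> /(lleD2l (- b)); rewrite addNr addKr => /lleN2; rewrite opprK oppr0.
Qed.

End LGroupOrder.

(** This is a total preorder on V, where [P x] reads x >= 0 and [~ P (- x)] reads x > 0.
    Antisymmetry is not imposed: the elements [null] below stand for 0, and the totally ordered
    quotient is never formed. *)
Definition total_cone (V : zmodType) (P : V -> Prop) :=
  (forall x y, P x -> P y -> P (x + y)) /\ (forall x, P x \/ P (- x)).

(* The cone of elements that are nonnegative modulo a prime convex l-subgroup. *)
Record prime_cone (A : abelianLGroupType) (P : A -> Prop) : Prop := PrimeCone {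
  prime_cone_total : total_cone P;
  prime_cone_ge0 : forall x, lle 0 x -> P x;
  prime_cone_join : forall x y, P (x - y) -> P (x - ljoin x y);
  prime_cone_meet : forall x y, P (x - y) -> P (lmeet x y - y)
}.

Section Ideals.
Variables (A : abelianLGroupType).
Implicit Types (x y z a : A) (I : set A).

(* Positive cones of convex l-subgroups, except that the empty set is allowed. *)
Definition ideal I :=
  (forall x, I x -> lle 0 x) /\
  (forall x y z, I x -> I y -> lle 0 z -> lle z (x + y) -> I z).

(** Subadditivity of [negpart] gives closure under sums, and primality applied to the disjoint parts
    of x gives totality. For joins and meets, the negative parts of x - [ljoin x y] and [lmeet x y]
    - y are bounded by that of x - y. *)
Lemma prime_cone_of_ideal I : ideal I -> I 0 ->
  (forall x y, lle 0 x -> lle 0 y -> disjoint x y -> I x \/ I y) ->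
  prime_cone (fun x => I (negpart x)).
Proof.
move=> [I0 Iadd] I00 Iprime.
have Ile x y : I y -> lle 0 x -> lle x y -> I x.
  by move=> Iy x0 xy; apply: (Iadd y 0) => //; rewrite addr0.
split.
- split=> [x y Px Py|x].
    exact: Iadd Px Py (negpart_ge0 _) (negpartD _ _).
  by apply: Iprime; [apply: negpart_ge0.. | apply: disjoint_negpart].
- by move=> x /negpart_eq0->.
- move=> x y Pxy; apply: (Ile _ _ Pxy (negpart_ge0 _)).
  apply: negpart_le (negpart_ge0 _); rewrite opprB; apply/lle_subLR.
  apply: lle_join.
    by rewrite -{1}[x]addr0; apply/lleD2l/negpart_ge0.
  by apply/lle_subLR; rewrite -opprB; apply: negpart_ge.
- move=> x y Pxy; apply: (Ile _ _ Pxy (negpart_ge0 _)).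
  apply: negpart_le (negpart_ge0 _); rewrite opprB; apply/lle_subLR.
  rewrite addrC; apply/lle_subLR; apply: lle_meet.
    apply/lle_subLR; rewrite addrC; apply/lle_subLR; rewrite -opprB.
    exact: negpart_ge.
  apply/lle_subLR; rewrite addrC -{1}[y]addr0.
  by apply/lleD2l/negpart_ge0.
Qed.

(** Take an ideal I maximal among those that omit b = [negpart a]. If disjoint u and v both lay
    outside I, maximality would give b <= c + k u and b <= d + l v with c, d in I. Then b - (c + d)
    is below the disjoint elements k u and l v, so b <= c + d and b is in I. *)
Lemma exists_prime_cone a : ~ lle 0 a -> exists2 P, prime_cone P & ~ P a.
Proof.
move=> a_lt0; set b := negpart a.
have b0 : lle 0 b by apply: negpart_ge0.
have bN0 : b <> 0 by move/negpart_eq0.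
have [|I [[idI nIb] maxI]] := @Zorn_bigcup A (fun I => ideal I /\ ~ I b).
  move=> F FP chF; split; last by move=> [X FX /=]; case: (FP X FX).
  split=> [x [X FX]|x y z [X FX Xx] [Y FY Yy] z0 zxy].
    by case: (FP X FX) => [[+ _] _]; apply.
  have [XY|YX] := chF X Y FX FY.
    exists Y => //; case: (FP Y FY) => [[_ addY] _].
    by apply: (addY x y) => //; apply: XY.
  exists X => //; case: (FP X FX) => [[_ addX] _].
  by apply: (addX x y) => //; apply: YX.
(* The empty chain has empty union, so I could a priori be empty; then the ideal {0}, which omits b,
   would be strictly larger. *)
have I0 : I 0.
  have [//|nI0] := pselect (I 0).
  have IE x : ~ I x.
    by move=> Ix; case: nI0; apply: (idI.2 x x) => //; [apply: lle_refl|apply: lle0_add; apply: idI.1].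
  case: (maxI [set 0]%classic).
    by split=> [x /IE //|/(_ 0 erefl)].
  split; last exact: bN0.
  split=> [x ->|x y z -> -> z0 zle]; first exact: lle_refl.
  by apply: lle_anti => //; rewrite addr0 in zle.
have Iadd x y : I x -> I y -> I (x + y).
  move=> Ix Iy; apply: (idI.2 x y) => //; last exact: lle_refl.
  by apply: lle0_add; apply: idI.1.
have bound v : lle 0 v -> ~ I v -> exists c k, I c /\ lle b (c + v *+ k).
  move=> v0 nIv; set J := [set z | lle 0 z /\ exists c k, I c /\ lle z (c + v *+ k)]%classic.
  have [[]//|nJb] := pselect (J b).
  have IJ : (I `<=` J)%classic.
    move=> x Ix; split; first exact: idI.1.
    by exists x, 0%N; split=> //; rewrite mulr0n addr0; apply: lle_refl.
  case: (maxI J).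
    split=> [//|JI]; apply: nIv; apply: JI; split=> //; exists 0, 1%N; split=> //.
    by rewrite add0r mulr1n; apply: lle_refl.
  split=> //; split=> [x []//|x y z [x0 [c [k [Ic xle]]]] [y0 [d [l [Id yle]]]] z0 zle].
  split=> //; exists (c + d), (k + l)%N; split; first exact: Iadd.
  by apply: lle_trans zle _; rewrite mulrnDr addrACA; apply: lleD.
exists (fun x => I (negpart x)) => //; apply: prime_cone_of_ideal => // u v u0 v0 duv.
have [Iu|nIu] := pselect (I u); first by left.
have [Iv|nIv] := pselect (I v); first by right.
have [c [k [Ic cle]]] := bound u u0 nIu; have [d [l [Id dle]]] := bound v v0 nIv.
have c0 := idI.1 _ Ic; have d0 := idI.1 _ Id.
case: nIb; apply: (idI.2 c d) => //.
have /lle_subLR : lle (b - (c + d)) 0; last by rewrite addr0.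
have := disjointMn (k := l) v0 (disjointC (disjointMn (k := k) u0 (disjointC duv))).
apply; apply/lle_subLR.
  apply: lle_trans cle _; apply: lleD; last exact: lle_refl.
  by rewrite -{1}[c]addr0; apply/lleD2l.
apply: lle_trans dle _; apply: lleD; last exact: lle_refl.
by rewrite addrC -{1}[d]addr0; apply/lleD2l.
Qed.

End Ideals.

(** * Total cones and integer vectors *)

Section Cones.
Variables (V : zmodType) (P : V -> Prop).
Hypothesis coneP : total_cone P.
Implicit Types x y z : V.

Lemma coneD x y : P x -> P y -> P (x + y).
Proof. exact: coneP.1. Qed.

Lemma coneN x : ~ P x -> P (- x).
Proof. by case: (coneP.2 x). Qed.

Lemma cone0 : P 0.
Proof. by case: (coneP.2 0); rewrite ?oppr0. Qed.

Lemma coneMn x k : P x -> P (x *+ k).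
Proof.
by move=> Px; elim: k => [|k ih]; rewrite ?mulr0n ?mulrS; [apply: cone0|apply: coneD].
Qed.

Lemma coneMn_inv x k : P (x *+ k.+1) -> P x.
Proof.
move=> Pkx; have [//|/coneN PNx] := pselect (P x).
have -> : x = x *+ k.+1 + (- x) *+ k by rewrite mulrS mulNrn addrK.
by apply: coneD => //; apply: coneMn.
Qed.

Lemma cone_gt0D x y : P x -> ~ P (- y) -> ~ P (- (x + y)).
Proof. by move=> Px; apply: contra_not => /(coneD Px); rewrite opprD addNKr. Qed.

Lemma cone_gt0Mz x (d : int) : ~ P (- x) -> 0 < d -> ~ P (- (x *~ d)).
Proof.
case: d => [[//|d]|//] nPx _; apply: contra_not nPx => /=.
by rewrite -mulNrn; apply: coneMn_inv.
Qed.

Definition null x := P x /\ P (- x).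

Lemma null0 : null 0.
Proof. by split; rewrite ?oppr0; apply: cone0. Qed.

Lemma nullN x : null x -> null (- x).
Proof. by case=> Px PNx; split; rewrite ?opprK. Qed.

Lemma nullD x y : null x -> null y -> null (x + y).
Proof. by case=> Px PNx [Py PNy]; split; rewrite ?opprD; apply: coneD. Qed.

Lemma nullB x y : null x -> null y -> null (x - y).
Proof. by move=> Nx /nullN; apply: nullD. Qed.

Lemma nullMz x (d : int) : null x -> null (x *~ d).
Proof.
have pos k : null x -> null (x *+ k).
  by case=> Px PNx; split; rewrite -?mulNrn; apply: coneMn.
by case: d => k Nx; [apply: pos|apply/nullN/pos].
Qed.

Lemma nullMz_inv x (d : int) : d != 0 -> null (x *~ d) -> null x.
Proof.
have pos k : null (x *+ k.+1) -> null x.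
  by case; rewrite -mulNrn => /coneMn_inv Px /coneMn_inv PNx.
case: d => [[//|k]|k] _; first exact: pos.
by move=> /nullN; rewrite opprK => /pos.
Qed.

Lemma null_transr x y : null (x - y) -> P y -> P x.
Proof. by case=> + _ Py => /coneD /(_ Py); rewrite subrK. Qed.

Lemma null_transl x y : null (x - y) -> P x -> P y.
Proof. by move=> /nullN; rewrite opprB; apply: null_transr. Qed.

End Cones.

Lemma total_cone_comp (U V : zmodType) (P : V -> Prop) (h : U -> V) :
  {morph h : x y / x + y} -> {morph h : x / - x} ->
  total_cone P -> total_cone (fun x => P (h x)).
Proof.
move=> hD hN [PD PN]; split=> [x y Px Py|x]; first by rewrite hD; apply: PD.
by rewrite hN; apply: PN.
Qed.

(** This supplies the value of the eliminated coordinate in [cone_separation]. A point that works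
    for the tail of [lo] is kept if it exceeds the new bound l, and otherwise replaced by one
    between l and [hi]. *)
Lemma rat_between (lo hi : seq rat) :
    (forall l h, l \in lo -> h \in hi -> l < h) ->
  exists x, (forall l, l \in lo -> l < x) /\ (forall h, h \in hi -> x < h).
Proof.
have above (l : rat) (s : seq rat) : (forall h, h \in s -> l < h) ->
    exists2 x : rat, l < x & forall h, h \in s -> x < h.
  elim: s => [_|h s ih lts]; first by exists (l + 1) => //; lra.
  have [|x lx xs] := ih; first by move=> g gs; apply: lts; rewrite inE gs orbT.
  have lh : l < h by apply: lts; rewrite mem_head.
  exists (Num.min x ((l + h) / 2)); first by rewrite lt_min lx; lra.
  move=> g; rewrite inE gt_min => /orP[/eqP->|/xs->//].
  by apply/orP; right; lra.
have below (s : seq rat) : exists x : rat, forall h, h \in s -> x < h.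
  elim: s => [|h s [x xs]]; first by exists 0.
  exists (Num.min x (h - 1)) => g; rewrite inE gt_min => /orP[/eqP->|/xs->//].
  by apply/orP; right; lra.
elim: lo => [_|l lo ih lohi]; first by have [x xhi] := below hi; exists x.
have [|x [lox xhi]] := ih.
  by move=> l' h l'lo hhi; apply: lohi => //; rewrite inE l'lo orbT.
have [lx|xl] := ltP l x.
  by exists x; split=> // l'; rewrite inE => /orP[/eqP->|/lox].
have [|y ly yhi] := above l hi.
  by move=> h hhi; apply: lohi => //; rewrite mem_head.
exists y; split=> // l'; rewrite inE => /orP[/eqP->//|/lox l'x].
exact: lt_trans (lt_le_trans l'x xl) ly.
Qed.

(* Fourier-Motzkin elimination of the first coordinate. *)
Lemma cone_separation r (P : 'rV[int]_r -> Prop) (L : seq 'rV[int]_r) :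
    total_cone P -> (forall s, s \in L -> ~ P (- s)) ->
  exists psi : 'cV[int]_r, forall s, s \in L -> 0 < (s *m psi) 0 0.
Proof.
elim: r P L => [|r ih] P L coneP L_gt0.
  exists 0 => s /L_gt0 []; rewrite [s]thinmx0 oppr0; exact: cone0.
rewrite -[r.+1]/(1 + r)%N in P L coneP L_gt0 *.
pose a (s : 'rV[int]_(1 + r)) := lsubmx s 0 0.
have aD s t : a (s + t) = a s + a t by rewrite /a linearD mxE.
have aMz s d : a (s *~ d) = a s * d.
  by rewrite /a -scaler_int linearZ mxE intz mulrC.
(* For a q < 0 < a p this is a positive combination of p and q in which the first coordinate
   cancels. *)
pose comb p q := p *~ (- a q) + q *~ a p.
have comb0 p q : a (comb p q) = 0 by rewrite aD !aMz; ring.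
have row0 s : a s = 0 -> s = row_mx 0 (rsubmx s).
  move=> as0; rewrite -{1}[s]hsubmxK; congr row_mx.
  by apply/rowP=> i; rewrite !ord1 -[LHS]/(a s) as0 mxE.
pose pos := [seq s <- L | 0 < a s]; pose neg := [seq s <- L | a s < 0].
pose L' := [seq rsubmx s | s <- L & a s == 0] ++
  [seq rsubmx (comb p q) | p <- pos, q <- neg].
have [||psi psiP] := ih (fun t => P (row_mx 0 t)) L'.
- by apply: total_cone_comp coneP => [s t|s]; rewrite ?add_row_mx ?opp_row_mx ?addr0 ?oppr0.
- move=> t; have -> : row_mx 0 (- t) = - row_mx (0 : 'rV_1) t by rewrite opp_row_mx oppr0.
  rewrite mem_cat => /orP[/mapP[s]|/allpairsP[[p q] /= []]].
    by rewrite mem_filter => /andP[/eqP/row0 as0 /L_gt0] + ->; rewrite -as0.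
  rewrite !mem_filter => /andP[ap /L_gt0 pP] /andP[aq /L_gt0 qP] ->.
  rewrite -row0 //; apply: cone_gt0D => //; last exact: cone_gt0Mz.
  have [//|/(coneN coneP) h] := pselect (P (p *~ - a q)).
  by case: (cone_gt0Mz (d := - a q) coneP pP _ h); rewrite oppr_gt0.
pose v (s : 'rV[int]_(1 + r)) : int := (rsubmx s *m psi) 0 0.
have vD s t : v (s + t) = v s + v t by rewrite /v linearD mulmxDl mxE.
have vMz s d : v (s *~ d) = v s * d.
  by rewrite /v -scaler_int linearZ -scalemxAl mxE intz mulrC.
(* With x as first coordinate of the functional, s imposes a s * x + v s > 0: a lower bound on x if
   a s > 0, an upper bound if a s < 0. Positivity at [comb p q] says that these bounds are
   compatible. *)
have [|x [xlo xhi]] := @rat_between [seq - (v p)%:~R / (a p)%:~R | p <- pos]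
    [seq (v q)%:~R / (- a q)%:~R | q <- neg].
  move=> _ _ /mapP[p pP ->] /mapP[q qP ->].
  have : 0 < v (comb p q) by apply: psiP; rewrite mem_cat orbC allpairs_f.
  rewrite vD !vMz => vpq.
  rewrite !mem_filter in pP qP; case/andP: pP => ap _; case/andP: qP => aq _.
  rewrite ltr_pdivrMr ?ltr0z // mulrAC ltr_pdivlMr ?ltr0z ?oppr_gt0 //.
  rewrite -!rmorphN -!rmorphM /= ltr_int; lia.
(* The rational solution (x, psi) is multiplied by the denominator of x. *)
exists (col_mx (numq x)%:M (psi *~ denq x)) => s sL.
have -> : (s *m col_mx (numq x)%:M (psi *~ denq x)) 0 0 = a s * numq x + v s * denq x.
  rewrite -[s in LHS]hsubmxK mul_row_col mxE mul_mx_scalar mxE mulrC; congr (_ + _).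
  by rewrite -scaler_int -scalemxAr mxE intz mulrC.
rewrite -(ltr0z rat) rmorphD !rmorphM /= -[x in numq x]/x.
have dx : 0 < (denq x)%:~R :> rat by rewrite ltr0z denq_gt0.
have -> : (numq x)%:~R = x * (denq x)%:~R by rewrite {1}numqE.
rewrite mulrA -mulrDl pmulr_lgt0 //.
have [as0|as0|as0] := ltrgt0P (a s).
- have : - (v s)%:~R / (a s)%:~R < x.
    by apply: xlo; apply/mapP; exists s; rewrite ?mem_filter ?as0.
  by rewrite ltr_pdivrMr ?ltr0z // => ?; lra.
- have : x < (v s)%:~R / (- a s)%:~R.
    by apply: xhi; apply/mapP; exists s; rewrite ?mem_filter ?as0.
  rewrite ltr_pdivlMr ?ltr0z ?oppr_gt0 // rmorphN /= => ?; lra.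
- rewrite as0 mul0r add0r ltr0z; apply: psiP; rewrite mem_cat.
  by apply/orP; left; apply: map_f; rewrite mem_filter as0 eqxx.
Qed.

(* By the Smith normal form, a nonzero vector of a pure subgroup is a multiple of
   a basis vector, which then lies in the subgroup and can be split off. *)
Lemma pure_subgroup_split k (B : 'rV[int]_k -> Prop) :
    B 0 -> (forall v w, B v -> B w -> B (v - w)) ->
    (forall v (d : int), d != 0 -> B (v *~ d) -> B v) ->
  exists r (M : 'M[int]_(k, r)) (S : 'M[int]_(r, k)),
    (forall v, B (v - v *m M *m S)) /\ (forall v, B v -> v *m M = 0).
Proof.
elim: k B => [|k ih] B B0 BB Bpure.
  by exists 0%N, 0, 0; split=> v; rewrite [v]thinmx0 ?sub0r ?mul0mx ?oppr0.
have [|/forallNP B1] := pselect (exists c, B c /\ c != 0); last first.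
  exists k.+1, 1%:M, 1%:M; split=> v; first by rewrite !mulmx1 subrr.
  by move=> Bv; rewrite mulmx1; apply: contra_notP (B1 v) => /eqP.
move=> [c [Bc c_neq0]]; rewrite -[k.+1]/(1 + k)%N in B B0 BB Bpure c Bc c_neq0 *.
have BN v : B v -> B (- v) by rewrite -[- v]sub0r; apply: BB.
have BD v w : B v -> B w -> B (v + w) by move=> Bv /BN; rewrite -[w in _ + w]opprK; apply: BB.
have BMz v (d : int) : B v -> B (v *~ d).
  have pos j : B v -> B (v *+ j) by move=> Bv; elim: j => [|j IH]; rewrite ?mulrS //; apply: BD.
  by case: d => j Bv; [apply: pos|apply/BN/pos].
have [L _ [R unitR [d _ cE]]] := int_Smith_normal_form c.
(* [e] identifies Z^k with the span of the rows of R after the first; the induction runs on the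
   preimage of B. *)
pose e (w : 'rV[int]_k) := row_mx (0 : 'rV_1) w *m R.
(* As c has a single row, its Smith form is an integer multiple of the first row of R, and purity
   puts that row in B. *)
have BR : B (row_mx (1 : 'rV_1) 0 *m R).
  have cR : c = (row_mx (1 : 'rV_1) 0 *m R) *~ (L 0 0 * d`_0).
    rewrite cE -scaler_int scalemxAl scale_row_mx scaler0; congr (_ *m R).
    apply/rowP=> j; rewrite mxE big_ord1 mxE; case: (split_ordP j) => i ->.
      by rewrite row_mxEl !mxE !ord1 intz /= mulr1.
    by rewrite row_mxEr mxE /= mulr0n mulr0.
  apply: (Bpure _ (L 0 0 * d`_0)); last by rewrite -cR.
  by apply: contra_neq c_neq0 => z; rewrite cR z mulr0z.
have eB v w : e (v - w) = e v - e w.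
  by rewrite /e -mulmxBl opp_row_mx add_row_mx subrr.
have [|v w ev ew|v z z_neq0|r [M [S [MS MB]]]] := ih (fun w => B (e w)).
- by rewrite /e row_mx0 mul0mx.
- by rewrite eB; apply: BB.
- have -> : e (v *~ z) = e v *~ z; last exact: Bpure.
  by rewrite /e -!scaler_int scalemxAl scale_row_mx scaler0.
exists r, (invmx R *m col_mx 0 M), (row_mx 0 S *m R).
have split_v v : let w := v *m invmx R in
    v = (row_mx (1 : 'rV_1) 0 *m R) *~ (lsubmx w 0 0) + e (rsubmx w).
  move=> w; rewrite /e -scaler_int scalemxAl -mulmxDl scale_row_mx scaler0.
  rewrite add_row_mx addr0 add0r -[LHS](mulmxKV unitR); congr (_ *m R).
  rewrite -[LHS]hsubmxK; congr row_mx; apply/rowP=> j.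
  by rewrite !mxE !ord1 intz /= mulr1.
have vM v : v *m (invmx R *m col_mx 0 M) = rsubmx (v *m invmx R) *m M.
  by rewrite mulmxA -{1}[v *m _]hsubmxK mul_row_col mulmx0 add0r.
split=> v; rewrite vM.
  rewrite {1}(split_v v) -addrA; apply: BD; first exact: BMz.
  rewrite !mulmxA mul_mx_row mulmx0 -/(e _) -eB; exact: MS.
move=> Bv; apply: MB; set w := v *m _.
have -> : e (rsubmx w) = v - (row_mx (1 : 'rV_1) 0 *m R) *~ (lsubmx w 0 0).
  by rewrite {1}(split_v v) [X in X - _]addrC addrK.
by apply: BB => //; apply: BMz.
Qed.

(** * Least positive elements and the subgroup they generate *)

Section LeastPositive.
Variables (V : zmodType) (P : V -> Prop) (f : V) (n : nat).
Hypotheses (coneP : total_cone P) (f_ge0 : P f).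
Hypothesis s_rankP : forall v, ~ P (- v) -> P (v *+ n - f).
Hypothesis divP : forall v p, ~ P (- v) -> ~~ (p %| n)%N -> (p < n)%N ->
  P ((v *+ p - f) *+ n.+1 - f) \/ P ((f - v *+ p) *+ n.+1 - f).

(* u is a positive element such that m u <= f with m as large as possible; two
   positive elements of sum u would give an h with 2m h <= f. *)
Lemma exists_least_positive : exists u m,
  [/\ P u, forall v, ~ P (- v) -> P (v - u), null P (f - u *+ m),
      null P u -> m = 0%N & m = 0%N \/ [&& 0 < m, m <= n & m %| n]%N].
Proof.
(* If f is null there need not be a least positive element, and u = 0, m = 0 satisfy every
   clause. *)
have [PNf|f_gt0] := pselect (P (- f)).
  exists 0, 0%N; split; rewrite ?subr0 //; try by [|left|exact: cone0].
  by move=> v /(coneN coneP); rewrite opprK subr0.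
pose below k := `[< exists2 g, ~ P (- g) & P (f - g *+ k) >].
have below1 : exists k, below k.
  by exists 1%N; apply/asboolP; exists f; rewrite ?subrr; last exact: cone0.
(* The rank inequality gives f <= n g, so k g <= f with k > n would make g nonpositive. *)
have below_le k : below k -> (k <= n)%N.
  move=> /asboolP[g g_gt0 Pfg]; rewrite leqNgt; apply/negP => nk; apply: (g_gt0).
  have := coneD coneP (s_rankP g_gt0) Pfg.
  have -> : k = (n + (k - n.+1).+1)%N by lia.
  by rewrite mulrnDr opprD !addrA subrK subrr add0r -mulNrn => /(coneMn_inv coneP).
case: (ex_maxnP below1 below_le) => m /asboolP[u u_gt0 Pfu] max_m.
have m_gt0 : (0 < m)%N.
  by apply: max_m; apply/asboolP; exists f; rewrite ?subrr; last exact: cone0.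
have u_least v : ~ P (- v) -> P (v - u).
  move=> v_gt0; have [//|vu] := pselect (P (v - u)).
  have [h h_gt0 Ph] : exists2 h, ~ P (- h) & P (u - h *+ 2).
    have [Pv|/(coneN coneP)] := pselect (P (u - v *+ 2)); first by exists v.
    exists (u - v); first by rewrite opprB.
    suff -> : u - (u - v) *+ 2 = - (u - v *+ 2) by [].
    rewrite mulrnBl !opprB addrCA; congr (_ + _).
    by rewrite mulr2n opprD addrA subrr sub0r.
  suff : below (m * 2)%N by move=> /max_m; lia.
  apply/asboolP; exists h => //.
  have -> : f - h *+ (m * 2) = (f - u *+ m) + (u - h *+ 2) *+ m.
    by rewrite mulrnBl addrA subrK -mulrnA mulnC.
  by apply: coneD => //; apply: coneMn.
have fu : null P (f - u *+ m).
  split=> //; have [//|nP] := pselect (P (- (f - u *+ m))).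
  suff : below m.+1 by move=> /max_m; rewrite ltnn.
  by apply/asboolP; exists u; rewrite // mulrSr opprD addrA; apply: u_least.
exists u, m; split=> //; first by have := coneN coneP u_gt0; rewrite opprK.
  by case=> _ /u_gt0.
have le_mn : (m <= n)%N by apply: below_le; apply/asboolP; exists u.
right; rewrite m_gt0 le_mn /=; apply/negPn/negP => ndvd.
have lt_mn : (m < n)%N.
  by move: le_mn; rewrite leq_eqVlt => /orP[/eqP eq_mn|//]; rewrite eq_mn dvdnn in ndvd.
(* Since f - m u is null, the divisibility inequality at u with p = m would yield - f >= 0. *)
have contra w : null P w -> P (w *+ n.+1 - f) -> False.
  by move=> /(nullMz coneP n.+1)[_ PN] /(coneD coneP PN); rewrite addrA addNr add0r.
case: (divP u_gt0 ndvd lt_mn); apply: contra => //.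
by rewrite -opprB; apply: nullN.
Qed.

End LeastPositive.

Section LeastPositiveSubgroup.
Variables (V : zmodType) (P : V -> Prop) (u : V).
Hypotheses (coneP : total_cone P) (u_ge0 : P u).
Hypothesis u_least : forall v, ~ P (- v) -> P (v - u).

(** This is Zu up to null elements. It is pure, so it can be split off, and convex, so a nonnegative
    element outside it exceeds every multiple of u. *)
Definition near_mul v := exists c : int, null P (v - u *~ c).

Lemma near_mul0 : near_mul 0.
Proof. by exists 0; rewrite mulr0z subr0; apply: null0. Qed.

Lemma near_mulB v w : near_mul v -> near_mul w -> near_mul (v - w).
Proof.
case=> c vc [d wd]; exists (c - d).
have -> : v - w - u *~ (c - d) = (v - u *~ c) - (w - u *~ d).
  by rewrite mulrzBr !opprB addrACA [RHS]addrACA; congr (_ + _); apply: addrC.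
exact: nullB.
Qed.

Lemma near_mulN v : near_mul v -> near_mul (- v).
Proof. by move=> /(near_mulB near_mul0); rewrite sub0r. Qed.

(** If d v = c u with d > 0, division with remainder gives w = v - (c %/ d) u with d w = r u and 0
    <= r < d. If w > 0 then w >= u, so r u >= d u, which forces u and then w to be null. *)
Lemma near_mul_pure v (d : int) : d != 0 -> near_mul (v *~ d) -> near_mul v.
Proof.
wlog d_gt0 : d / 0 < d => [gen d_neq0 vd|_ [c vc]].
  have [d_gt0|d_lt0|d0] := ltrgt0P d; [exact: gen vd| |by rewrite d0 in d_neq0].
  by apply: (gen (- d)); rewrite ?oppr_gt0 ?oppr_eq0 // mulrNz; apply: near_mulN.
set r := (c %% d)%Z; have r_ge0 : 0 <= r by rewrite modz_ge0 ?gt_eqF.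
exists (c %/ d)%Z; set w := v - _.
have wr : null P (w *~ d - u *~ r).
  suff -> : w *~ d - u *~ r = v *~ d - u *~ c by [].
  by rewrite /w [in RHS](divz_eq c d) mulrzBl [in RHS]mulrzDr mulrzA opprD addrA.
have Pur : P (u *~ r) by case: (r) r_ge0 => // k _; apply: coneMn.
have Pw : P w.
  have [//|nPw] := pselect (P w).
  case: (@cone_gt0Mz _ _ coneP (- w) d); rewrite ?opprK // mulNrz opprK.
  exact: null_transr wr Pur.
have [PNw//|w_gt0] := pselect (P (- w)).
have Pud : P (u *~ r - u *~ d).
  apply: (null_transl coneP _ (coneMn coneP `|d| (u_least w_gt0))).
  rewrite -[_ *+ _]/(_ *~ `|d|%:Z) gtz0_abs // mulrzBl.
  by rewrite opprB addrA subrK.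
have PNu : P (- u).
  have [//|u_gt0] := pselect (P (- u)).
  case: (cone_gt0Mz (d := d - r) coneP u_gt0); first by rewrite subr_gt0 ltz_pmod.
  by rewrite mulrzBr opprB.
suff : null P (w *~ d) by apply: nullMz_inv; rewrite ?gt_eqF.
by rewrite -[w *~ d](subrK (u *~ r)); apply: nullD => //; apply: nullMz.
Qed.

(** A positive v is at least u, so u can be subtracted from v while c drops by one; for c <= 0 the
    element v is null. *)
Lemma near_mul_convex v (c : int) : P v -> P (u *~ c - v) -> near_mul v.
Proof.
have u_nat k : P (u *+ k) by apply: coneMn.
case: c => k Pv; last first.
  move=> /(coneD coneP (u_nat k.+1)); rewrite NegzE mulrNz addrA subrr sub0r => PNv.
  by exists 0; rewrite mulr0z subr0.
elim: k v Pv => [|k ih] v Pv.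
  by rewrite mulr0z sub0r => PNv; exists 0; rewrite mulr0z subr0.
have [PNv _|v_gt0] := pselect (P (- v)); first by exists 0; rewrite mulr0z subr0.
have Pvu := u_least v_gt0.
rewrite -[_ *~ _]/(u *+ k.+1) mulrSr -addrA -opprB => /(ih _ Pvu)[c vc].
by exists (c + 1); rewrite mulrzDr mulr1z opprD [- _ - u]addrC addrA.
Qed.

End LeastPositiveSubgroup.

(** The map sends v to N psi(v M) + w dv(v). Here M is the quotient by the multiples of u, psi is
    positive on finitely many positive elements of that quotient, dv reads the remaining coefficient
    of u, and a large N imitates the lexicographic order on the list. *)
Lemma int_local_embedding k (P : 'rV[int]_k -> Prop) (f : 'rV[int]_k) (n : nat)
    (L : seq 'rV[int]_k) :
    total_cone P -> P f ->
    (forall v, ~ P (- v) -> P (v *+ n - f)) ->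
    (forall v p, ~ P (- v) -> ~~ (p %| n)%N -> (p < n)%N ->
      P ((v *+ p - f) *+ n.+1 - f) \/ P ((f - v *+ p) *+ n.+1 - f)) ->
  exists (phi : 'cV[int]_k) (m : nat),
    [/\ m = 0%N \/ [&& 0 < m, m <= n & m %| n]%N, (f *m phi) 0 0 = m
      & forall v, v \in L -> P v <-> 0 <= (v *m phi) 0 0].
Proof.
move=> coneP Pf s_rankP divP.
have [u [m [Pu u_least fu u_null m_dvd]]] := exists_least_positive coneP Pf s_rankP divP.
have [|||r [M [S [MS MB]]]] := @pure_subgroup_split k (near_mul P u).
- exact: near_mul0.
- exact: near_mulB.
- exact: near_mul_pure.
have /fin_all_exists[d dP] i : exists c, null P (row i (1%:M - M *m S) - u *~ c).
  rewrite rowE mulmxBr mulmx1 mulmxA; exact: MS.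
pose dv (v : 'rV[int]_k) := (v *m \col_i d i) 0 0.
have dvP v : null P (v - v *m M *m S - u *~ dv v).
  have -> : v - v *m M *m S = v *m (1%:M - M *m S) by rewrite mulmxBr mulmx1 mulmxA.
  rewrite mulmx_sum_row /dv mxE -scaler_int rmorph_sum scaler_suml -sumrB.
  apply: big_ind => [|x y|i _]; [exact: null0|exact: nullD|].
  have sz (a : int) (x : 'rV[int]_k) : a *: x = x *~ a by rewrite -{1}[a]intz scaler_int.
  by rewrite mxE /= intz !sz -mulrzA_C -mulrzBl; apply: nullMz.
(* The weight w is 1 if u > 0. If u is null, its coefficients carry no sign and m = 0, so w is 0. *)
have [w [w01 mw wP]] : exists w : int, [/\ 0 <= w <= 1, m%:Z * w = m &
    forall c, P (u *~ c) <-> 0 <= c * w].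
  have [Nu|nNu] := pselect (null P u).
    exists 0; split; rewrite ?u_null // => c; rewrite mulr0; split=> // _.
    exact: (nullMz coneP c Nu).1.
  exists 1; split; rewrite ?mulr1 // => c; rewrite mulr1; split; last first.
    by case: c => // c _; apply: coneMn.
  move=> Puc; rewrite leNgt; apply/negP => c_lt0.
  have u_gt0 : ~ P (- u) by move=> PNu; apply: nNu.
  case: (cone_gt0Mz (d := - c) coneP u_gt0); first by rewrite oppr_gt0.
  by rewrite mulrNz opprK.
pose L2 := L ++ [seq - v | v <- L].
(* The section S carries the cone over to the quotient. The list L2 contains the negatives of L, so
   that negative signs are reproduced too. *)
have [||psi psiP] := @cone_separation r (fun s => P (s *m S))
    [seq s <- [seq v *m M | v <- L2] | `[< ~ P (- s *m S) >]].
- by apply: total_cone_comp coneP => [s t|s]; rewrite ?mulmxDl ?mulNmx.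
- by move=> s; rewrite mem_filter => /andP[/asboolP].
have [N NP] : exists N : int, forall v, v \in L2 -> `|dv v| < N.
  elim: L2 {psiP} => [|v l [N NP]]; first by exists 0.
  exists (Num.max N (`|dv v| + 1)) => x; rewrite inE lt_max => /orP[/eqP->|/NP->//].
  by rewrite ltrDl ltr01 orbT.
exists (M *m psi *~ N + \col_i d i *~ w), m.
have phiE v :
    (v *m (M *m psi *~ N + \col_i d i *~ w)) 0 0 = (v *m M *m psi) 0 0 * N + dv v * w.
  have entryE (a b : int) (X Y : 'M[int]_1) : (X *~ a + Y *~ b) 0 0 = X 0 0 * a + Y 0 0 * b.
    by rewrite -!scaler_int !mxE !intz mulrC [b * _]mulrC.
  by rewrite -entryE mulmxDr -!scaler_int -!scalemxAr mulmxA.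
(* If v M S were not positive, v would be at most dv(v) u and convexity would make it a multiple of
   u. So psi(v M) >= 1, and N exceeds the absolute value of the other term. *)
have key v : v \in L2 -> P v -> ~ near_mul P u v -> 0 < (v *m M *m psi) 0 0 * N + dv v * w.
  move=> vL Pv v_far; have := NP v vL.
  suff : 0 < (v *m M *m psi) 0 0 by move: w01 ((v *m M *m psi) 0 0) (dv v); nia.
  apply: psiP; rewrite mem_filter (map_f (mulmx^~ M)) // andbT; apply/asboolP => PNv.
  apply: v_far; apply: (near_mul_convex coneP Pu u_least (c := dv v)) => //.
  have := coneD coneP (dvP v).2 PNv; rewrite mulNmx !opprB.
  by rewrite addrA addrAC addrK.
have near0 v : near_mul P u v -> v *m M *m psi = 0 /\ null P (v - u *~ dv v).
  by move=> /MB vM; have := dvP v; rewrite vM !mul0mx subr0.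
split=> [//||v vL]; rewrite phiE.
  have [fM fd] : f *m M *m psi = 0 /\ null P (f - u *~ dv f) by apply: near0; exists m.
  rewrite fM mxE mul0r add0r -[RHS]mw; apply/eqP; rewrite -subr_eq0 -mulrBl.
  have := nullB coneP fu fd; rewrite opprB addrC addrA subrK pmulrn -mulrzBr => -[/wP].
  by rewrite -mulrNz => + /wP; lia.
have [/near0[vM vd]|v_far] := pselect (near_mul P u v).
  rewrite vM mxE mul0r add0r -wP.
  by split; [apply: (null_transl coneP vd)|apply: (null_transr coneP vd)].
have [Pv|nPv] := pselect (P v).
  by split=> // _; apply/ltW/key => //; rewrite mem_cat vL.
split=> //; rewrite leNgt => /negP[].
have vNL : - v \in L2 by rewrite mem_cat map_f ?orbT.
have vN_far : ~ near_mul P u (- v) by move=> /(near_mulN coneP); rewrite opprK.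
have := key _ vNL (coneN coneP nPv) vN_far; rewrite /dv !mulNmx.
have entryN (X : 'M[int]_1) : (- X) 0 0 = - X 0 0 by rewrite mxE.
by rewrite !entryN !mulNr -opprD oppr_gt0.
Qed.

(** * Valuations in the integers *)

Section PrimeConeTheory.
Variables (A : abelianLGroupType) (P : A -> Prop).
Hypothesis primeP : prime_cone P.
Let coneP := prime_cone_total primeP.

Lemma prime_cone_join_null x y : P (x - y) -> null P (x - ljoin x y).
Proof.
move=> Pxy; split; first exact: prime_cone_join.
by apply: prime_cone_ge0 => //; rewrite opprB; apply/lle_sub0/lle_joinl.
Qed.

Lemma prime_cone_meet_null x y : P (x - y) -> null P (lmeet x y - y).
Proof.
move=> Pxy; split; first exact: prime_cone_meet.
by apply: prime_cone_ge0 => //; rewrite opprB; apply/lle_sub0/lle_meetr.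
Qed.

Lemma prime_cone_joinP x y : P (ljoin x y) -> P x \/ P y.
Proof.
have [Pxy|/(coneN coneP)] := pselect (P (x - y)).
  by move=> Pj; left; exact: (null_transr coneP (prime_cone_join_null Pxy) Pj).
rewrite opprB ljoinC => Pyx Pj; right.
exact: (null_transr coneP (prime_cone_join_null Pyx) Pj).
Qed.

End PrimeConeTheory.

Lemma min_close (x y a b c d : int) :
  `|x - a| <= c -> `|y - b| <= d -> `|Num.min x y - Num.min a b| <= c + d.
Proof. lia. Qed.

Lemma max_close (x y a b c d : int) :
  `|x - a| <= c -> `|y - b| <= d -> `|Num.max x y - Num.max a b| <= c + d.
Proof. lia. Qed.

Section IntegerValuations.
Variables (A : pointedLGroupType) (n : nat).
Local Notation val_prod := (direct_prod (fun _ : A -> int => ZZ n)).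

(* [represents g a]: some term with variables in A takes the value a at the
   identity valuation and the value g v at each valuation v in Z_n. *)
Inductive represents : val_prod -> A -> Prop :=
  | RepVar a : represents (fun v => v a) a
  | RepZero : represents 0 0
  | RepOpp g a : represents g a -> represents (- g) (- a)
  | RepAdd g a h b : represents g a -> represents h b -> represents (g + h) (a + b)
  | RepMeet g a h b :
      represents g a -> represents h b -> represents (lmeet g h) (lmeet a b)
  | RepJoin g a h b :
      represents g a -> represents h b -> represents (ljoin g h) (ljoin a b)
  | RepPoint : represents point point.

Definition lin (s : seq A) (w : 'rV[int]_(size s)) : A :=
  \sum_(j < size s) nth 0 s j *~ w 0 j.

(** An element outside s has index [size s], which matches no column, so its row and all its
    valuations are 0. *)
Definition unit_row (s : seq A) (a : A) : 'rV[int]_(size s) :=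
  \row_j (index a s == j)%:R.

Definition valuation s (phi : 'cV[int]_(size s)) (a : A) : int :=
  (unit_row s a *m phi) 0 0.

Lemma linD s : {morph @lin s : v w / v + w}.
Proof.
move=> v w; rewrite /lin -big_split; apply: eq_bigr => j _.
by rewrite mxE mulrzDr.
Qed.

Lemma linN s : {morph @lin s : v / - v}.
Proof.
move=> v; rewrite /lin -sumrN; apply: eq_bigr => j _.
by rewrite mxE mulrNz.
Qed.

Lemma lin0 s : lin (0 : 'rV_(size s)) = 0.
Proof. by rewrite -(subrr 0) linD linN subrr. Qed.

Lemma linMn s (v : 'rV_(size s)) k : lin (v *+ k) = lin v *+ k.
Proof. by elim: k => [|k ih]; rewrite ?mulr0n ?lin0 // !mulrS linD ih. Qed.

Lemma lin_unit_row s a : a \in s -> lin (unit_row s a) = a.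
Proof.
move=> sa; have lt_a : (index a s < size s)%N by rewrite index_mem.
rewrite /lin (bigD1 (Ordinal lt_a)) //= mxE eqxx mulr1z nth_index //.
rewrite big1 ?addr0 // => j; rewrite mxE -val_eqE /= eq_sym => /negPf->.
by rewrite mulr0z.
Qed.

Definition preserves_signs (P : A -> Prop) s (L : seq 'rV[int]_(size s))
    (phi : 'cV[int]_(size s)) :=
  forall v, v \in L -> P (lin v) <-> 0 <= (v *m phi) 0 0.

Lemma preserves_cons P s v (L : seq 'rV[int]_(size s)) phi :
  preserves_signs P (v :: L) phi ->
  (P (lin v) <-> 0 <= (v *m phi) 0 0) /\ preserves_signs P L phi.
Proof.
move=> sgn; split; first by apply: sgn; rewrite mem_head.
by move=> w wL; apply: sgn; rewrite inE wL orbT.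
Qed.

Lemma preserves_cat P s (L1 L2 : seq 'rV[int]_(size s)) phi :
  preserves_signs P (L1 ++ L2) phi ->
  preserves_signs P L1 phi /\ preserves_signs P L2 phi.
Proof. by move=> sgn; split=> v vL; apply: sgn; rewrite mem_cat vL ?orbT. Qed.

(* The error term accounts for valuations phi that do not send point to n: it
   vanishes when they do, and is unchanged by scaling phi when phi(point) = 0. *)
Lemma represents_linear P g a : prime_cone P -> represents g a ->
  exists s0 : seq A, forall s, {subset s0 <= s} ->
  exists (w : 'rV[int]_(size s)) (L : seq 'rV[int]_(size s)) (C : nat),
    null P (a - lin w) /\ forall phi, preserves_signs P L phi ->
      `|g (valuation phi) - (w *m phi) 0 0 : int|
        <= C%:Z * `|n%:Z - valuation phi point|.
Proof.
move=> primeP; have coneP := prime_cone_total primeP.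
have mx00D k (v w : 'rV[int]_k) (phi : 'cV[int]_k) :
    ((v + w) *m phi) 0 0 = (v *m phi) 0 0 + (w *m phi) 0 0.
  by rewrite mulmxDl mxE.
have mx00N k (v : 'rV[int]_k) (phi : 'cV[int]_k) :
    ((- v) *m phi) 0 0 = - (v *m phi) 0 0.
  by rewrite mulNmx mxE.
have subset_cat2 (s1 s2 s : seq A) :
    {subset s1 ++ s2 <= s} -> {subset s1 <= s} /\ {subset s2 <= s}.
  by move=> sub; split=> x xs; apply: sub; rewrite mem_cat xs ?orbT.
have nullE x y : x = y -> null P (x - y) by move=> ->; rewrite subrr; apply: null0.
have null_trans y x z : null P (x - y) -> null P (y - z) -> null P (x - z).
  by move=> Nxy Nyz; rewrite -[x - z](subrKA y); apply: nullD.
have compare s x y (v w : 'rV_(size s)) : null P (x - lin v) -> null P (y - lin w) ->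
    P (x - y) /\ P (lin (v - w)) \/ P (y - x) /\ ~ P (lin (v - w)).
  move=> Nx Ny; have Nxy : null P (x - y - lin (v - w)).
    have -> : x - y - lin (v - w) = x - lin v - (y - lin w).
      rewrite linD linN !opprB addrACA [RHS]addrACA; congr (_ + _); exact: addrC.
    exact: nullB.
  have [Pvw|nPvw] := pselect (P (lin (v - w))).
    by left; split=> //; apply: (null_transr coneP Nxy Pvw).
  right; split=> //; rewrite -opprB; apply: coneN => // Pxy; apply: nPvw.
  exact: (null_transl coneP Nxy Pxy).
elim=> {g a}.
- move=> a; exists [:: a] => s sa; exists (unit_row s a), [::], 0%N; split.
    by apply: nullE; rewrite lin_unit_row // sa ?mem_head.
  by move=> phi _; rewrite mul0r normr_le0 subrr.
- exists [::] => s _; exists 0, [::], 0%N; split; first by rewrite lin0; apply: nullE.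
  by move=> phi _; rewrite mul0r mul0mx mxE normr_le0 subrr.
- move=> g a _ [s0 IH]; exists s0 => s /IH[w [L [C [Nw bound]]]].
  exists (- w), L, C; split; first by rewrite linN -opprD; apply: nullN.
  by move=> phi /bound; rewrite mx00N -opprD normrN.
(* Quantifying over every s that contains s0 lets both induction hypotheses be used on one common
   list. *)
- move=> g a h b _ [s1 IH1] _ [s2 IH2]; exists (s1 ++ s2) => s.
  move=> /subset_cat2[/IH1[w1 [L1 [C1 [N1 B1]]]] /IH2[w2 [L2 [C2 [N2 B2]]]]].
  exists (w1 + w2), (L1 ++ L2), (C1 + C2)%N; split.
    by rewrite linD opprD addrACA; apply: nullD.
  move=> phi /preserves_cat[/B1 b1 /B2 b2].
  rewrite mx00D PoszD mulrDl; move: b1 b2.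
  by rewrite -[X in `|X - (_ + _)|]/(g _ + h _ : int); lia.
- move=> g a h b _ [s1 IH1] _ [s2 IH2]; exists (s1 ++ s2) => s.
  move=> /subset_cat2[/IH1[w1 [L1 [C1 [N1 B1]]]] /IH2[w2 [L2 [C2 [N2 B2]]]]].
  (* Adding w1 - w2 to the list forces phi to order the two arguments as P does, so the meet is
     represented by the same argument on both sides. *)
  case: (compare _ _ _ _ _ N1 N2) => -[ab w12].
    exists w2, ((w1 - w2) :: L1 ++ L2), (C1 + C2)%N; split.
      by apply: null_trans N2; apply: prime_cone_meet_null.
    move=> phi /preserves_cons[[/(_ w12) + _] /preserves_cat[/B1 b1 /B2 b2]].
    rewrite mx00D mx00N subr_ge0 PoszD mulrDl => w21.
    by have := min_close b1 b2; rewrite (min_r w21).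
  exists w1, ((w1 - w2) :: L1 ++ L2), (C1 + C2)%N; split.
    by apply: null_trans N1; rewrite lmeetC; apply: prime_cone_meet_null.
  move=> phi /preserves_cons[[_ /contra_not/(_ w12) +] /preserves_cat[/B1 b1 /B2 b2]].
  rewrite mx00D mx00N subr_ge0 PoszD mulrDl => /negP; rewrite -ltNge => /ltW w12'.
  by have := min_close b1 b2; rewrite (min_l w12').
- move=> g a h b _ [s1 IH1] _ [s2 IH2]; exists (s1 ++ s2) => s.
  move=> /subset_cat2[/IH1[w1 [L1 [C1 [N1 B1]]]] /IH2[w2 [L2 [C2 [N2 B2]]]]].
  case: (compare _ _ _ _ _ N1 N2) => -[ab w12].
    exists w1, ((w1 - w2) :: L1 ++ L2), (C1 + C2)%N; split.
      by apply: null_trans N1; rewrite -opprB; apply: nullN; apply: prime_cone_join_null.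
    move=> phi /preserves_cons[[/(_ w12) + _] /preserves_cat[/B1 b1 /B2 b2]].
    rewrite mx00D mx00N subr_ge0 PoszD mulrDl => w21.
    by have := max_close b1 b2; rewrite (max_l w21).
  exists w2, ((w1 - w2) :: L1 ++ L2), (C1 + C2)%N; split.
    by apply: null_trans N2; rewrite ljoinC -opprB; apply: nullN; apply: prime_cone_join_null.
  move=> phi /preserves_cons[[_ /contra_not/(_ w12) +] /preserves_cat[/B1 b1 /B2 b2]].
  rewrite mx00D mx00N subr_ge0 PoszD mulrDl => /negP; rewrite -ltNge => /ltW w12'.
  by have := max_close b1 b2; rewrite (max_r w12').
- exists [:: point] => s sp; exists (unit_row s point), [::], 1%N; split.
    by apply: nullE; rewrite lin_unit_row // sp ?mem_head.
  by move=> phi _; rewrite mul1r.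
Qed.

Hypotheses (point_ge0 : pAL_plus A)
  (axiomsA : forall t, rank_div_axioms n t -> ineq_holds A t).

Lemma eval_TMuln (e : nat -> A) k t : eval e (TMuln k t) = eval e t *+ k.
Proof. by elim: k => [|k ih] //=; rewrite mulrS -ih. Qed.

Lemma ineq_holds_lle t (e : nat -> A) : ineq_holds A t -> lle 0 (eval e t).
Proof. by move=> /(_ e) /= h; rewrite /lle lmeetC. Qed.

Lemma prime_cone_s_rank (P : A -> Prop) x : prime_cone P -> ~ P (- x) -> P (x *+ n - point).
Proof.
move=> primeP nPNx; have := @ineq_holds_lle _ (fun=> x) (axiomsA (or_introl erefl)).
rewrite /s_rank [eval _ _]/= eval_TMuln /= => /(prime_cone_ge0 primeP).
by case/(prime_cone_joinP primeP).
Qed.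

Lemma prime_cone_div (P : A -> Prop) x p :
    prime_cone P -> ~ P (- x) -> ~~ (p %| n)%N -> (p < n)%N ->
  P ((x *+ p - point) *+ n.+1 - point) \/ P ((point - x *+ p) *+ n.+1 - point).
Proof.
move=> primeP nPNx ndvd lt_pn; have coneP := prime_cone_total primeP.
have := @ineq_holds_lle _ (fun=> x) (axiomsA (or_intror (ex_intro _ p (And3 ndvd lt_pn erefl)))).
rewrite /div_ineq /TSub; cbn beta iota zeta delta [eval].
rewrite !eval_TMuln; cbn beta iota zeta delta [eval].
rewrite !eval_TMuln => /(prime_cone_ge0 primeP).
case/(prime_cone_joinP primeP) => // Pd.
(* Where P makes u the larger argument, the join may be replaced by u. *)
have max_le u v : P (u - v) -> P (ljoin u v *+ n.+1 - point) -> P (u *+ n.+1 - point).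
  move=> /(prime_cone_join primeP)/(coneMn coneP n.+1) Puj /(coneD coneP Puj).
  by rewrite mulrnBl addrA subrK.
set u := x *+ p - point in Pd *; set v := point - x *+ p in Pd *.
have [Puv|/(coneN coneP)] := pselect (P (u - v)); first by left; apply: (max_le _ _ Puv Pd).
by rewrite opprB => Pvu; right; rewrite ljoinC in Pd; apply: (max_le _ _ Pvu Pd).
Qed.

(** If a is not nonnegative, a prime cone omits it and yields an integral phi that is negative at
    the linear form w of a. At q phi that form is at most - q, while g differs from it by less than
    q, so g takes a negative value. *)
Lemma represents_ge0 g a :
  represents g a -> (forall v, 0 <= g v :> int) -> lle 0 a.
Proof.
move=> ga g_ge0; have [//|/exists_prime_cone[P primeP nPa]] := pselect (lle 0 a).
have coneP := prime_cone_total primeP.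
have [s0 s0P] := represents_linear primeP ga.
have [|w [L [C [aw bound]]]] := s0P (point :: s0); first by move=> x; rewrite inE orbC => ->.
set s := point :: s0 in w L aw bound.
have lin_point : lin (unit_row s point) = point by rewrite lin_unit_row ?mem_head.
pose Q (v : 'rV[int]_(size s)) := P (lin v).
have coneQ : total_cone Q by apply: total_cone_comp coneP; [apply: linD|apply: linN].
have [|||phi [m [m_dvd phi_point sgn]]] :=
  @int_local_embedding _ Q (unit_row s point) n (w :: L) coneQ.
- by rewrite /Q lin_point; apply: prime_cone_ge0.
- by move=> v; rewrite /Q linD !linN linMn lin_point; apply: prime_cone_s_rank.
- move=> v p; rewrite /Q !(linD, linN, linMn) lin_point; exact: prime_cone_div.
have w_lt0 : (w *m phi) 0 0 < 0.
  rewrite ltNge; apply/negP => /((sgn w (mem_head _ _)).2) Pw; apply: nPa.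
  exact: (null_transr coneP aw Pw).
(* If m > 0, then q = n / m makes the error vanish; if m = 0, the error stays at most C n and q = C
   n + 1 exceeds it. *)
have [q q_gt0 qP] : exists2 q, (0 < q)%N & C%:Z * `|n%:Z - (q * m)%N%:Z| < q.
  case: m_dvd => [->|/and3P[m_gt0 le_mn /dvdnP[q nE]]].
    exists (C * n).+1 => //; rewrite muln0 subr0; lia.
  exists q; first by case: q nE => // nE; rewrite nE leqNgt m_gt0 in le_mn.
  by rewrite -nE subrr normr0 mulr0; case: q nE => // nE; rewrite nE leqNgt m_gt0 in le_mn.
have phiq v : (v *m (phi *+ q)) 0 0 = (v *m phi) 0 0 * q.
  by rewrite -scaler_nat -scalemxAr mxE mulrC natz.
have /bound : preserves_signs P L (phi *+ q).
  by move=> v vL; rewrite phiq pmulr_lge0 //; apply: sgn; rewrite inE vL orbT.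
have -> : valuation (phi *+ q) point = (q * m)%N by rewrite /valuation phiq phi_point mulrC.
rewrite phiq => /le_lt_trans/(_ qP) close; exfalso.
have : (w *m phi) 0 0 * q <= - (q%:Z) by rewrite -mulN1r ler_wpM2r // lerN10 // -ltzD1.
move=> wq; have := g_ge0 (valuation (phi *+ q)); rewrite leNgt => /negP[].
by move: close; rewrite ltr_distl => /andP[_ /lt_le_trans]; apply; rewrite -lerBrDr sub0r.
Qed.

End IntegerValuations.

(** * Subalgebras and the class operators *)

Record subalg_closed (A : pointedLGroupType) (S : A -> Prop) : Prop := SubalgClosed {
  subalg_zero : S 0;
  subalg_opp : forall x, S x -> S (- x);
  subalg_add : forall x y, S x -> S y -> S (x + y);
  subalg_meet : forall x y, S x -> S y -> S (lmeet x y);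
  subalg_join : forall x y, S x -> S y -> S (ljoin x y);
  subalg_point : S point
}.

(** The closure proof is a parameter of the type so that the algebra instances can be inferred from
    the type alone. *)
Definition subalg (A : pointedLGroupType) (S : A -> Prop)
  (_ : subalg_closed S) : Type := {x | S x}.

Section Subalgebra.
Variables (A : pointedLGroupType) (S : A -> Prop) (clS : subalg_closed S).
Local Notation B := (subalg clS).
Implicit Types x y z : B.

HB.instance Definition _ := gen_eqMixin B.
HB.instance Definition _ := gen_choiceMixin B.

Fact subalg_inj x y : sval x = sval y -> x = y.
Proof. by case: x y => x Sx [y Sy] /= xy; apply: eq_exist. Qed.

Definition sub_zero : B := exist S 0 (subalg_zero clS).
Definition sub_opp x : B := exist S (- sval x) (subalg_opp clS (svalP x)).
Definition sub_add x y : B :=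
  exist S (sval x + sval y) (subalg_add clS (svalP x) (svalP y)).
Definition sub_meet x y : B :=
  exist S (lmeet (sval x) (sval y)) (subalg_meet clS (svalP x) (svalP y)).
Definition sub_join x y : B :=
  exist S (ljoin (sval x) (sval y)) (subalg_join clS (svalP x) (svalP y)).
Definition sub_point : B := exist S point (subalg_point clS).

Fact sub_addA : associative sub_add.
Proof. by move=> x y z; apply/subalg_inj/addrA. Qed.
Fact sub_addC : commutative sub_add.
Proof. by move=> x y; apply/subalg_inj/addrC. Qed.
Fact sub_add0 : left_id sub_zero sub_add.
Proof. by move=> x; apply/subalg_inj/add0r. Qed.
Fact sub_addN : left_inverse sub_zero sub_opp sub_add.
Proof. by move=> x; apply/subalg_inj/addNr. Qed.

HB.instance Definition _ := GRing.isZmodule.Build B sub_addA sub_addC sub_add0 sub_addN.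

Fact sub_meetC : commutative sub_meet.
Proof. by move=> x y; apply/subalg_inj/lmeetC. Qed.
Fact sub_joinC : commutative sub_join.
Proof. by move=> x y; apply/subalg_inj/ljoinC. Qed.
Fact sub_meetA : associative sub_meet.
Proof. by move=> x y z; apply/subalg_inj/lmeetA. Qed.
Fact sub_joinA : associative sub_join.
Proof. by move=> x y z; apply/subalg_inj/ljoinA. Qed.
Fact sub_meet_joinK x y : sub_meet x (sub_join x y) = x.
Proof. exact/subalg_inj/lmeet_joinK. Qed.
Fact sub_join_meetK x y : sub_join x (sub_meet x y) = x.
Proof. exact/subalg_inj/ljoin_meetK. Qed.
Fact sub_meet_leD2l x y z : sub_meet x y = x -> sub_meet (z + x) (z + y) = z + x.
Proof. by move=> xy; apply/subalg_inj/lmeet_leD2l; rewrite -[in RHS]xy. Qed.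

HB.instance Definition _ := isLGroup.Build B sub_meetC sub_joinC
  sub_meetA sub_joinA sub_meet_joinK sub_join_meetK sub_meet_leD2l.
HB.instance Definition _ := isPointed.Build B sub_point.

Lemma subalg_val_hom : @is_hom B A (@sval A S).
Proof. by []. Qed.

End Subalgebra.

Lemma eval_hom (A B : pointedLGroupType) (h : A -> B) e t :
  is_hom h -> h (eval e t) = eval (h \o e) t.
Proof.
case=> h0 hN hD hI hU hp; elim: t => //= [s <-|s <- t <-|s <- t <-|s <- t <-].
- exact: hN.
- exact: hD.
- exact: hI.
- exact: hU.
Qed.

Lemma eval_direct_prod (I : Type) (A_ : I -> pointedLGroupType)
    (e : nat -> direct_prod A_) t i :
  eval e t i = eval (fun k => e k i) t.
Proof.
by elim: t => //= [s <-|s <- t <-|s <- t <-|s <- t <-].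
Qed.

(** An evaluation in the quotient lifts along the surjection by choice; the lifted identity is then
    checked in the product, coordinate by coordinate. *)
Lemma HSP_ineq_holds (K : alg_class) t A :
  (forall B, K B -> ineq_holds B t) -> HSP K A -> ineq_holds A t.
Proof.
move=> Kt [B [C [I A_ KA] [g g_hom g_inj]] [h h_hom h_surj]] e.
have /choice[e' e'P] k := h_surj (e k).
have -> : e = h \o e' by apply/funext => k /=; rewrite e'P.
rewrite -eval_hom // -(hom_zero h_hom); congr h.
apply: g_inj; rewrite eval_hom // (hom_zero g_hom).
apply: functional_extensionality_dep => i; rewrite eval_direct_prod; exact: Kt.
Qed.

(** * Validity of the axioms in [ZZ n] *)

Lemma eval_TMuln_ZZ n (e : nat -> ZZ n) k t :
  eval e (TMuln k t) = (eval e t : int) * k%:Z.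
Proof. by rewrite eval_TMuln -natz mulr_natr. Qed.

Lemma ZZ_s_rank n : ineq_holds (ZZ n) (s_rank n).
Proof.
move=> e; pose x : int := e 0%N.
rewrite -[LHS]/(Num.min (Num.max ((eval e (TMuln n (TVar 0)) : int) - n%:Z) (- x)) 0).
rewrite eval_TMuln_ZZ -[(eval e _ : int)]/x.
have [x_gt0|x_le0] := ltP 0 x; last by lia.
have : 0 <= x * n%:Z - n%:Z by nia.
lia.
Qed.

(** For x > 0 the integers p x and n differ, so their distance D is at least 1 and (n + 1) D exceeds
    n. *)
Lemma ZZ_div n p : ~~ (p %| n)%N -> ineq_holds (ZZ n) (div_ineq p n).
Proof.
move=> ndvd e; pose x : int := e 0%N.
set px := TMuln p (TVar 0); set d := TJoin (TSub px TPoint) (TSub TPoint px).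
rewrite -[LHS]/(Num.min (Num.max ((eval e (TMuln n.+1 d) : int) - n%:Z) (- x)) 0).
rewrite eval_TMuln_ZZ.
have -> : eval e d = Num.max (x * p%:Z - n%:Z) (n%:Z - x * p%:Z).
  rewrite -[LHS]/(Num.max ((eval e px : int) - n%:Z) (n%:Z - (eval e px : int))).
  by rewrite eval_TMuln_ZZ.
have [x_gt0|x_le0] := ltP 0 x; last by lia.
have px_neq : x * p%:Z != n%:Z.
  apply: contra ndvd => /eqP xp; apply/dvdnP; exists `|x|%N.
  by apply/eqP; rewrite -eqz_nat PoszM gtz0_abs ?xp.
set D := Num.max (x * p%:Z - _) _; have : 1 <= D by rewrite /D; lia.
move=> D_ge1; have : n.+1%:Z <= D * n.+1%:Z by rewrite ler_peMl.
lia.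
Qed.

(** The functions that represent some element of A form a subalgebra. If g represents a and b, then
    g - g = 0 represents both differences, so [represents_ge0] gives a = b. Hence h is a
    homomorphism, and the projections make it onto. *)
Lemma HSP_ZZ_of_axioms n (A : pointedLGroupType) : pAL_plus A ->
  (forall t, rank_div_axioms n t -> ineq_holds A t) -> HSP (eq (ZZ n)) A.
Proof.
move=> A_ge0 axA; pose S g := exists a, @represents A n g a.
have clS : subalg_closed S.
  split.
  - by exists 0; apply: RepZero.
  - by move=> g [a ga]; exists (- a); apply: RepOpp.
  - by move=> g h [a ga] [b hb]; exists (a + b); apply: RepAdd.
  - by move=> g h [a ga] [b hb]; exists (lmeet a b); apply: RepMeet.
  - by move=> g h [a ga] [b hb]; exists (ljoin a b); apply: RepJoin.
  - by exists point; apply: RepPoint.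
pose h (g : subalg clS) : A := projT1 (cid (svalP g)).
have hP g : represents (sval g) (h g) by rewrite /h; case: cid.
have uniq g a b : @represents A n g a -> represents g b -> a = b.
  have le a' b' : @represents A n g a' -> represents g b' -> lle a' b'.
    move=> ga gb; apply/lle_sub0; apply: (represents_ge0 A_ge0 axA (RepAdd gb (RepOpp ga))).
    by move=> v; rewrite subrr.
  by move=> ga gb; apply: lle_anti; apply: le.
have hE g a : represents (sval g) a -> h g = a by apply: uniq.
exists (subalg clS).
  exists (direct_prod (fun _ : A -> int => ZZ n)); first by split.
  by exists (@sval _ S); [apply: subalg_val_hom|apply: subalg_inj].
exists h.
  split.
  - by apply: hE; apply: RepZero.
  - by move=> g; apply: hE; apply: RepOpp (hP g).
  - by move=> g k; apply: hE; apply: RepAdd (hP g) (hP k).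
  - by move=> g k; apply: hE; apply: RepMeet (hP g) (hP k).
  - by move=> g k; apply: hE; apply: RepJoin (hP g) (hP k).
  - by apply: hE; apply: RepPoint.
by move=> a; exists (exist _ (fun v => v a) (ex_intro _ a (RepVar _ a))); apply: hE; apply: RepVar.
Qed.

Theorem theorem5p3 (n : nat) :
  axiomatized_within (HSP (eq (ZZ n))) pAL_plus (rank_div_axioms n).
Proof.
move=> A; split=> [VA|[]]; last exact: HSP_ZZ_of_axioms.
have VA_ineq t : ineq_holds (ZZ n) t -> ineq_holds A t.
  by move=> tn; apply: HSP_ineq_holds VA => _ <-.
split=> [|t].
  (* Membership in [pAL_plus] is itself an inequality, so it transfers from [ZZ n] like the
     axioms. *)
  have : ineq_holds A TPoint.
    by apply: VA_ineq => e.
  by move=> /(_ (fun=> 0)) /= h; rewrite /pAL_plus /lle lmeetC.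
case=> [->|[p [ndvd lt_pn ->]]]; apply: VA_ineq; [exact: ZZ_s_rank|exact: ZZ_div].
Qed.
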